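(* For every fixed integer $s \ge 1$, there are only finitely many (up to isomorphism) $5$-vertex-critical $(P_5, K_{1,s}+P_1)$-free graphs.
   Context: All graphs are finite, simple and undirected. $P_t$ denotes the path on $t$ vertices, $K_{1,s}$ the star with $s$ leaves, and $G+H$ the disjoint union of graphs $G$ and $H$ (so $K_{1,s}+P_1$ is the disjoint union of $K_{1,s}$ and an isolated vertex). A graph is $(H_1,H_2)$-free if it contains no induced subgraph isomorphic to $H_1$ or to $H_2$. A graph $G$ is $k$-vertex-critical if $\chi(G)=k$ and $\chi(G-v)<k$ for every vertex $v\in V(G)$, where $\chi$ is the chromatic number. *)

(* Defs.v *)
From mathcomp Require Import all_boot.

Set Implicit Arguments.
Unset Strict Implicit.
Unset Printing Implicit Defensive.

Record sgraph := SGraph {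
  vertex :> finType;
  adj : rel vertex;
  adj_sym : symmetric adj;
  adj_irrefl : irreflexive adj }.

Arguments adj {s} : rename.

Definition isomorphic (G H : sgraph) : Prop :=
  exists2 f : G -> H, bijective f & forall x y, adj (f x) (f y) = adj x y.

Section Induced.
Variables (G : sgraph) (A : {set G}).

Definition induced_adj : rel {x : G | x \in A} :=
  fun x y => adj (val x) (val y).

Fact induced_sym : symmetric induced_adj.
Proof. by move=> x y; apply: adj_sym. Qed.

Fact induced_irrefl : irreflexive induced_adj.
Proof. by move=> x; apply: adj_irrefl. Qed.

Definition induced : sgraph := SGraph induced_sym induced_irrefl.
End Induced.

Definition del_vertex (G : sgraph) (v : G) : sgraph := induced (~: [set v]).

Section Path.
Variable t : nat.

Definition path_adj : rel 'I_t := fun i j => (i.+1 == j) || (j.+1 == i).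

Fact path_sym : symmetric path_adj.
Proof. by move=> i j; rewrite /path_adj orbC. Qed.

Fact path_irrefl : irreflexive path_adj.
Proof. by move=> i; rewrite /path_adj orbb gtn_eqF. Qed.

(* [t] counts vertices, not edges. *)
Definition path_graph : sgraph := SGraph path_sym path_irrefl.
End Path.

Section Star.
Variable s : nat.

(* [None] is the centre and the [Some i] are the [s] leaves. *)
Definition star_adj : rel (option 'I_s) := fun x y => isSome x != isSome y.

Fact star_sym : symmetric star_adj.
Proof. by move=> x y; rewrite /star_adj eq_sym. Qed.

Fact star_irrefl : irreflexive star_adj.
Proof. by move=> x; rewrite /star_adj eqxx. Qed.

Definition star_graph : sgraph := SGraph star_sym star_irrefl.
End Star.

Section DisjointUnion.
Variables G H : sgraph.

Definition dunion_adj : rel (G + H)%type := fun x y =>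
  match x, y with
  | inl a, inl b => adj a b
  | inr a, inr b => adj a b
  | _, _ => false
  end.

Fact dunion_sym : symmetric dunion_adj.
Proof. by move=> [a|a] [b|b] //=; apply: adj_sym. Qed.

Fact dunion_irrefl : irreflexive dunion_adj.
Proof. by move=> [a|a] /=; apply: adj_irrefl. Qed.

Definition dunion : sgraph := SGraph dunion_sym dunion_irrefl.
End DisjointUnion.

Definition free (H G : sgraph) : Prop :=
  ~ exists A : {set G}, isomorphic (induced A) H.

Definition free2 (H1 H2 G : sgraph) : Prop := free H1 G /\ free H2 G.

Definition colorable (G : sgraph) (k : nat) : bool :=
  [exists c : {ffun G -> 'I_k},
    [forall x, forall y, adj x y ==> (c x != c y)]].

Fact ex_colorable (G : sgraph) : exists k, colorable G k.
Proof.
exists #|G|; apply/existsP; exists [ffun x => enum_rank x].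
apply/forallP => x; apply/forallP => y; apply/implyP => xy.
rewrite !ffunE (inj_eq enum_rank_inj).
by apply: contraTneq xy => ->; rewrite adj_irrefl.
Qed.

Definition chi (G : sgraph) : nat := ex_minn (ex_colorable G).

Definition vertex_critical (k : nat) (G : sgraph) : Prop :=
  chi G = k /\ forall v : G, chi (del_vertex v) < k.

Definition finitely_many_up_to_iso (P : sgraph -> Prop) : Prop :=
  exists (n : nat) (F : 'I_n -> sgraph),
    forall G : sgraph, P G -> exists i, isomorphic G (F i).

(* Main.v *)
(** Let [I] be a large stable set of a [k]-vertex-critical [(P5, K_{1,s}+P1)]-free
    graph [G], let [A] be the set of vertices complete to [I], and [H] the set of
    the other vertices.  A vertex of [H] has at most [s] neighbours in [I], so a
    vertex of [H] with many neighbours in [H] would, by Ramsey's theorem, be the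
    centre of an induced star missed by some vertex of [I].  Hence [G[H]] has
    bounded degree and, being [P5]-free, bounded components, and many of them meet
    [I].  A vertex of [A] has neighbours in each of these components and, by
    [P5]-freeness, is complete to all but at most one.  Choose one, [Cr], of least
    chromatic number, colour [G - r] with [k - 1] colours for some [r] in [Cr], and
    let [T] be the set of colours used on [A].  If there are more than [k]
    components, one of the others is complete to representatives in [A] of all
    colours of [T], so it avoids [T], and [Cr] can be recoloured without [T]: [G]
    is [(k - 1)]-colourable, a contradiction.  So stable sets of [G] are bounded,
    cliques have at most [k] vertices, and Ramsey's theorem bounds [G]. *)

Require Import Defs.
From mathcomp Require Import all_boot zify.

Set Implicit Arguments.
Unset Strict Implicit.
Unset Printing Implicit Defensive.

(** * Cardinalities of finite sets *)

Lemma card_bigcup_le (I T : finType) (S : {set I}) (F : I -> {set T}) n :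
  (forall i, i \in S -> #|F i| <= n) -> #|\bigcup_(i in S) F i| <= #|S| * n.
Proof.
move=> Fn; rewrite -sum_nat_const.
apply: (@leq_trans (\sum_(i in S) #|F i|)); last exact: leq_sum.
elim/big_rec2: _ => [|i m X _ IH]; first by rewrite cards0.
by rewrite (leq_trans (leq_card_setU _ _)) // leq_add2l.
Qed.

Lemma subset_of_card (T : finType) (S : {set T}) n :
  n <= #|S| -> exists2 L : {set T}, L \subset S & #|L| = n.
Proof.
move=> nS; exists [set x in take n (enum S)].
  by apply/subsetP => x; rewrite inE => /mem_take; rewrite mem_enum.
by rewrite cardsE (card_uniqP _) ?take_uniq ?enum_uniq // size_takel // -cardE.
Qed.

(** * Chromatic number *)

Lemma colorableP (G : sgraph) k :
  reflect (exists c : G -> 'I_k, forall x y, adj x y -> c x != c y)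
          (colorable G k).
Proof.
apply: (iffP existsP) => [[c /forallP cP]|[c cP]].
  by exists c => x y; move/forallP/(_ y)/implyP: (cP x).
exists (finfun c); apply/forallP => x; apply/forallP => y; apply/implyP => xy.
by rewrite !ffunE cP.
Qed.

Lemma colorable_leq (G : sgraph) m n : m <= n -> colorable G m -> colorable G n.
Proof.
move=> mn /colorableP[c cP]; apply/colorableP; exists (widen_ord mn \o c).
by move=> x y /cP; apply: contraNneq => /= /(congr1 val) /= /val_inj ->.
Qed.

Lemma chi_leq (G : sgraph) k : (chi G <= k) = colorable G k.
Proof.
rewrite /chi; case: ex_minnP => m mP m_min.
by apply/idP/idP => [mk|/m_min //]; apply: colorable_leq mP.
Qed.

(** Renumbering the colours outside [T] gives a colouring with exactly that many colours. *)
Lemma colorable_avoiding (G : sgraph) k (T : {set 'I_k}) (c : G -> 'I_k) :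
  (forall x y, adj x y -> c x != c y) -> (forall x, c x \notin T) ->
  colorable G #|~: T|.
Proof.
move=> cP cT; have cT' x : c x \in ~: T by rewrite inE.
apply/colorableP; exists (fun x => enum_rank_in (cT' x) (c x)) => x y /cP.
apply: contraNneq => /(congr1 enum_val).
by rewrite !enum_rankK_in // => ->.
Qed.

(** Turns a colouring of an induced subgraph into a total function on [G]: vertices outside [S] get
    the colour of [x0]. *)
Lemma colorable_extend (G : sgraph) (S : {set G}) x0 k :
  x0 \in S -> colorable (induced S) k ->
  exists c : G -> 'I_k, {in S &, forall x y, adj x y -> c x != c y}.
Proof.
move=> x0S /colorableP[c cP].
pose y0 : induced S := exist _ x0 x0S.
exists (fun x => c (insubd y0 x)) => x y xS yS xy; apply: cP.
by rewrite /= /induced_adj !insubdK.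
Qed.

(** * Induced subgraphs *)

Lemma free_embed (H G : sgraph) (f : H -> G) :
  free H G -> injective f -> (forall x y, adj (f x) (f y) = adj x y) -> False.
Proof.
move=> HG f_inj fP; apply: HG; exists (f @: setT).
have fA x : f x \in f @: setT by rewrite imset_f.
pose h x : induced (f @: setT) := exist _ (f x) (fA x).
have h_inj : injective h by move=> x y /(congr1 val) /= /f_inj.
have [|g hK gK] := inj_card_bij h_inj.
  by rewrite card_sig card_imset // cardsT.
exists g; first by exists h.
by move=> x y; rewrite -{2}[x]gK -{2}[y]gK -fP.
Qed.

Lemma no_induced_P5 (G : sgraph) (a b c d e : G) : free (path_graph 5) G ->
  adj a b -> adj b c -> adj c d -> adj d e ->
  ~~ adj a c -> ~~ adj a d -> ~~ adj a e -> ~~ adj b d -> ~~ adj b e ->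
  ~~ adj c e -> False.
Proof.
move=> GP ab bc cd de /negbTE ac /negbTE ad /negbTE ae /negbTE bd /negbTE be
  /negbTE ce.
pose f (i : path_graph 5) : G := tnth [tuple a; b; c; d; e] i.
have fP x y : adj (f x) (f y) = adj x y.
  rewrite /f !(tnth_nth a) /= /path_adj.
  case: x y => [[|[|[|[|[|x]]]]] //= _] [[|[|[|[|[|y]]]]] //= _];
    rewrite ?adj_irrefl //; rewrite ?[adj b a]adj_sym ?[adj c a]adj_sym
     ?[adj d a]adj_sym ?[adj e a]adj_sym ?[adj c b]adj_sym ?[adj d b]adj_sym
     ?[adj e b]adj_sym ?[adj d c]adj_sym ?[adj e c]adj_sym ?[adj e d]adj_sym //.
apply: (free_embed GP _ fP) => x y fxy.
(* Injectivity of [f]: adjacency to the vertices 0, 1 and 3 already tells the five vertices of the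
   path apart. *)
have tw z : path_adj x z = path_adj y z by rewrite -[LHS]fP -[RHS]fP fxy.
apply/val_inj; move: (tw ord0) (tw (inord 1)) (tw (inord 3)).
rewrite /path_adj !inordK //=.
by case: x y {fxy tw} => [[|[|[|[|[|x]]]]] //= _] [[|[|[|[|[|y]]]]] //= _].
Qed.

Definition nbrs (G : sgraph) (x : G) : {set G} := [set y | adj x y].

Definition stable (G : sgraph) (S : {set G}) : Prop :=
  {in S &, forall x y, ~~ adj x y}.

Definition clique (G : sgraph) (S : {set G}) : Prop :=
  {in S &, forall x y, x != y -> adj x y}.

Lemma no_induced_star_plus_point (G : sgraph) s (c w : G) (L : {set G}) :
  free (dunion (star_graph s) (path_graph 1)) G ->
  stable L -> #|L| = s -> L \subset nbrs c ->
  w != c -> ~~ adj w c -> {in L, forall x, w != x /\ ~~ adj w x} -> False.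
Proof.
move=> GP Ls Lcard /subsetP Lc wc /negbTE adj_wc wL.
pose l (i : 'I_s) : G := enum_val (cast_ord (esym Lcard) i).
have lL i : l i \in L by apply: enum_valP.
have adj_cl i : adj c (l i) by have := Lc _ (lL i); rewrite inE.
have adj_wl i : adj w (l i) = false by have [_ /negbTE] := wL _ (lL i).
have adj_ll i j : adj (l i) (l j) = false by apply/negbTE/Ls.
pose f (x : dunion (star_graph s) (path_graph 1)) : G :=
  match x with
  | inl None => c
  | inl (Some i) => l i
  | inr _ => w
  end.
have cl i : c != l i.
  by apply/eqP => E; have := adj_cl i; rewrite -E adj_irrefl.
apply: (@free_embed _ _ f GP).
  move=> [[i|]|i] [[j|]|j] //= E.
  - by congr (inl (Some _)); apply/(cast_ord_inj (eq_n := esym Lcard))/enum_val_inj.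
  - by have := cl i; rewrite E eqxx.
  - by case: (wL _ (lL i)); rewrite E eqxx.
  - by have := cl j; rewrite E eqxx.
  - by rewrite E eqxx in wc.
  - by case: (wL _ (lL j)); rewrite E eqxx.
  - by rewrite E eqxx in wc.
  - by rewrite [i]ord1 [j]ord1.
move=> [[i|]|i] [[j|]|j] /=; rewrite ?adj_irrefl /star_adj ?[adj _ w]adj_sym //.
- by rewrite [adj _ c]adj_sym adj_cl.
- by rewrite adj_cl.
- by rewrite [i]ord1 [j]ord1 path_irrefl.
Qed.

(** * Ramsey's theorem *)

(** Upper bound on Ramsey numbers: R(p+1, q+1) = R(p, q+1) + R(p+1, q) + 1, and 0 when an argument
    is 0. The inner [fix] makes the recursion structural in both arguments. *)
Fixpoint ramsey (p q : nat) : nat :=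
  let fix ramsey_p q :=
    match p, q with
    | p'.+1, q'.+1 => (ramsey p' q + ramsey_p q').+1
    | _, _ => 0
    end in ramsey_p q.

Lemma ramseyP p q (G : sgraph) (S : {set G}) : ramsey p q <= #|S| ->
  (exists K : {set G}, [/\ K \subset S, clique K & #|K| = p]) \/
  (exists K : {set G}, [/\ K \subset S, stable K & #|K| = q]).
Proof.
elim: p q S => [|p IHp] q.
  by move=> S _; left; exists set0; rewrite sub0set cards0; split=> // x; rewrite inE.
elim: q => [|q IHq] S.
  by move=> _; right; exists set0; rewrite sub0set cards0; split=> // x; rewrite inE.
rewrite [ramsey _ _]/= -[X in (_ + X)]/(ramsey p.+1 q) => S_big.
have /card_gt0P[x xS] : 0 < #|S| by apply: leq_trans S_big.
pose N := S :&: nbrs x; pose M := (S :\ x) :\: nbrs x.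
have xN : x \notin N by rewrite !inE adj_irrefl andbF.
have xM : x \notin M by rewrite !inE eqxx andbF.
have NM : #|S| = (#|N| + #|M|).+1.
  rewrite (cardsD1 x) xS add1n -(cardsID (nbrs x)); congr (_ + _).+1.
  apply: eq_card => y; rewrite !inE; case: eqP => [->|//].
  by rewrite adj_irrefl !andbF.
have NS : N \subset S by apply: subsetIl.
have MS : M \subset S by apply: subset_trans (subsetDl _ _) (subsetDl _ _).
(* Pigeonhole; the successor in the recurrence accounts for [x] itself. *)
have [N_big|M_big] : ramsey p q.+1 <= #|N| \/ ramsey p.+1 q <= #|M| by lia.
  have [[K [KN Kc Kp]]|[K [KN Ks Kq]]] := IHp _ _ N_big; last first.
    by right; exists K; rewrite (subset_trans KN).
  left; exists (x |: K); rewrite subUset sub1set xS (subset_trans KN) //.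
  rewrite cardsU1 Kp (contra (subsetP KN x)) //; split=> // y z.
  have xK u : u \in K -> adj x u.
    by move/(subsetP KN); rewrite !inE => /andP[].
  rewrite !inE => /predU1P[->|yK] /predU1P[->|zK]; rewrite ?eqxx // => yz.
  - exact: xK.
  - by rewrite adj_sym xK.
  - exact: Kc.
have [[K [KM Kc Kp]]|[K [KM Ks Kq]]] := IHq _ M_big.
  by left; exists K; rewrite (subset_trans KM).
right; exists (x |: K); rewrite subUset sub1set xS (subset_trans KM) //.
rewrite cardsU1 Kq (contra (subsetP KM x)) //; split=> // y z.
have xK u : u \in K -> ~~ adj x u.
  by move/(subsetP KM); rewrite !inE => /andP[].
rewrite !inE => /predU1P[->|yK] /predU1P[->|zK]; rewrite ?adj_irrefl //.
- exact: xK.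
- by rewrite adj_sym xK.
- exact: Ks.
Qed.

Lemma clique_leq_chi (G : sgraph) (K : {set G}) : clique K -> #|K| <= chi G.
Proof.
move=> Kc; have /colorableP[c cP] : colorable G (chi G) by rewrite -chi_leq.
rewrite -[X in _ <= X]card_ord -(card_in_imset (f := c)) ?max_card // => x y xK yK.
by move=> E; apply/eqP; apply: contraTT isT => /(Kc _ _ xK yK)/cP; rewrite E eqxx.
Qed.

(** * Components of an induced subgraph *)

Section Components.
Variables (G : sgraph) (H : {set G}).

(** Edges of G[H] as a relation on all of [G], so that components are sets of vertices of [G];
    vertices outside [H] are isolated. *)
Definition radj : rel G := fun x y => [&& x \in H, y \in H & adj x y].

Definition comp (x : G) : {set G} := [set y | connect radj x y].

Lemma radj_sym : symmetric radj.
Proof. by move=> x y; rewrite /radj adj_sym andbCA. Qed.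

Lemma radj_connect_sym : connect_sym radj.
Proof. by apply: sym_connect_sym; apply: radj_sym. Qed.

Lemma comp_refl x : x \in comp x.
Proof. by rewrite inE connect0. Qed.

Lemma comp_sub x : x \in H -> comp x \subset H.
Proof.
move=> xH; apply/subsetP => y; rewrite inE => xy.
rewrite -(@closed_connect _ radj (mem H) _ _ _ xy) // => u v /and3P[uH vH _].
by rewrite uH vH.
Qed.

Lemma comp_closed x y z :
  y \in comp x -> y \in H -> z \in H -> adj y z -> z \in comp x.
Proof.
rewrite !inE => xy yH zH yz; apply: connect_trans xy (connect1 _).
by rewrite /radj yH zH.
Qed.

(** Without such an edge, the neighbours of [a] in the component would be closed under [radj], hence
    would form the whole component. *)
Lemma comp_mixed_edge x (a : G) y z :
  y \in comp x -> z \in comp x -> adj a y -> ~~ adj a z ->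
  exists u v, [/\ u \in comp x, v \in comp x, adj u v, adj a u & ~~ adj a v].
Proof.
rewrite !inE => xy xz ay az.
have [/existsP[u /existsP[v /and5P[]]]|] := boolP [exists u, exists v,
    [&& u \in comp x, v \in comp x, radj u v, adj a u & ~~ adj a v]].
  by move=> xu xv /and3P[_ _ uv] au av; exists u, v.
move=> /existsPn nuv; case/negP: az.
pose P := [pred u | (u \in comp x) && adj a u].
have Pcl : closed radj P.
  apply: intro_closed; first exact: radj_connect_sym.
  move=> u v uv /andP[xu au]; have xv : v \in comp x.
    by move: xu; rewrite !inE => xu; apply: connect_trans xu (connect1 uv).
  move/existsPn/(_ v): (nuv u); rewrite xu xv uv au /= negbK.
  by rewrite inE xv.
have yz : connect radj y z.
  by apply: connect_trans xz; rewrite radj_connect_sym.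
by have := closed_connect Pcl yz; rewrite !inE xy ay => /esym/andP[].
Qed.

Fixpoint ball n (x : G) : {set G} :=
  if n is n'.+1 then ball n' x :|: \bigcup_(y in ball n' x) [set z | radj y z]
  else [set x].

(** Each step multiplies the size by at most [D.+1]; centres outside [H] add nothing. *)
Lemma ball_card D x n : (forall y, y \in H -> #|nbrs y :&: H| <= D) ->
  #|ball n x| <= D.+1 ^ n.
Proof.
move=> HD; elim: n => [|n IH] /=; first by rewrite cards1.
rewrite (leq_trans (leq_card_setU _ _)) //.
apply: (@leq_trans (#|ball n x| + #|ball n x| * D)).
  rewrite leq_add2l; apply: card_bigcup_le => y _.
  have [yH|yH] := boolP (y \in H).
    apply: leq_trans (HD y yH); apply/subset_leq_card/subsetP => z.
    by rewrite !inE => /and3P[_ -> ->].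
  rewrite (_ : [set _ | _] = set0) ?cards0 //; apply/setP => z.
  by rewrite !inE /radj (negbTE yH).
by rewrite -mulnS expnSr leq_mul2r IH orbT.
Qed.

Lemma ball_step n x y z : y \in ball n x -> radj y z -> z \in ball n.+1 x.
Proof.
by move=> yB yz /=; rewrite inE; apply/orP; right; apply/bigcupP; exists y; rewrite ?inE.
Qed.

Lemma ball_new n x z : z \in ball n.+1 x -> z \notin ball n x ->
  exists2 y, y \in ball n x & radj y z.
Proof.
by rewrite /= inE => /orP[->//|/bigcupP[y yB]]; rewrite inE => yz _; exists y.
Qed.

Lemma ball_old n x y z : z \notin ball n.+1 x -> y \in ball n x -> radj y z = false.
Proof. by move=> zB yB; apply: contraNF zB => /(ball_step yB). Qed.

Lemma ball_subS n x y : y \in ball n x -> y \in ball n.+1 x.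
Proof. by move=> yB /=; rewrite inE yB. Qed.

(* Walking back from distance 4 along the spheres gives an induced path. *)
Lemma ball4 x : free (path_graph 5) G -> ball 4 x = ball 3 x.
Proof.
move=> GP; apply/eqP; rewrite eqEsubset andbC; apply/andP; split.
  by apply/subsetP => y; apply: ball_subS.
apply/subsetP => e e4; apply: contraTT isT => e3.
have [d d3 de] := ball_new e4 e3.
have d2 : d \notin ball 2 x by apply: contra e3 => /ball_step; apply.
have [c c2 cd] := ball_new d3 d2.
have c1 : c \notin ball 1 x by apply: contra d2 => /ball_step; apply.
have [b b1 bc] := ball_new c2 c1.
have b0 : b \notin ball 0 x by apply: contra c1 => /ball_step; apply.
have [a a0 ab] := ball_new b1 b0.
have [e2 e1] : e \notin ball 2 x /\ e \notin ball 1 x.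
  by split; apply: contra e3; [|move/ball_subS]; apply: ball_subS.
have d1 : d \notin ball 1 x by apply: contra d2; apply: ball_subS.
have adjE u v : u \in H -> v \in H -> radj u v = false -> ~~ adj u v.
  by rewrite /radj => -> -> /= ->.
case/and3P: ab => aH bH ab; case/and3P: bc => _ cH bc.
case/and3P: cd => _ dH cd; case/and3P: de => _ eH de.
by case: (no_induced_P5 GP ab bc cd de);
  apply: adjE => //;
  [apply: ball_old c1 a0|apply: ball_old d1 a0|apply: ball_old e1 a0
  |apply: ball_old d2 b1|apply: ball_old e2 b1|apply: ball_old e3 c2].
Qed.

(** By [ball4], the ball of radius 3 is closed under [radj], so it contains the component. *)
Lemma comp_card D x : free (path_graph 5) G ->
  (forall y, y \in H -> #|nbrs y :&: H| <= D) -> #|comp x| <= D.+1 ^ 3.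
Proof.
move=> GP HD; apply: leq_trans (ball_card x 3 HD).
apply/subset_leq_card/subsetP => y; rewrite inE => xy.
have cl : closed radj (mem (ball 3 x)).
  apply: intro_closed; first exact: radj_connect_sym.
  by move=> u v uv u3; rewrite -ball4 //; apply: ball_step uv.
rewrite -(closed_connect cl xy); do 3! apply: ball_subS.
by rewrite inE.
Qed.
End Components.

(** * Stable sets in critical graphs *)

Section StableBound.
Variables (k s : nat) (G : sgraph).
Hypothesis Gcrit : vertex_critical k G.
Hypothesis GP5 : free (path_graph 5) G.
Hypothesis Gstar : free (dunion (star_graph s) (path_graph 1)) G.

Let r0 := ramsey k.+1 s.
(** Degree bound in G[H]: at most [r0] neighbours outside [I] and at most [s] inside. *)
Let D := r0 + s.

Lemma large_has_stable (S : {set G}) : r0 <= #|S| ->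
  exists K : {set G}, [/\ K \subset S, stable K & #|K| = s].
Proof.
move/ramseyP => [[K [_ /clique_leq_chi]]|//].
by rewrite Gcrit.1 => Kk Kk1; rewrite Kk1 ltnn in Kk.
Qed.

Variable I : {set G}.
Hypothesis Istab : stable I.
Hypothesis I_big : s * s + s + 1 < #|I|.

Let A : {set G} := [set a | I \subset nbrs a].
Let H := ~: A.

Lemma stable_sub_nonA : I \subset H.
Proof.
apply/subsetP => w wI; rewrite !inE; apply/negP => /subsetP/(_ _ wI).
by rewrite inE adj_irrefl.
Qed.

(** A vertex of [H] outside [I] misses some [w] in [I]; with [s] neighbours in [I] as leaves and [w]
    as the isolated point it would give the forbidden graph. *)
Lemma few_nbrs_in_stable x : x \in H -> #|nbrs x :&: I| <= s.
Proof.
move=> xH; have [xI|xI] := boolP (x \in I).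
  rewrite (_ : _ :&: _ = set0) ?cards0 //; apply/setP => y; rewrite !inE.
  by apply/andP => -[xy yI]; have := Istab xI yI; rewrite xy.
rewrite leqNgt; apply/negP => /ltnW/subset_of_card[L /subsetIP[Lx LI] Ls].
move: xH; rewrite !inE => /subsetPn[w wI]; rewrite inE => xw.
apply: (no_induced_star_plus_point Gstar _ Ls Lx (w := w)).
- by move=> y z /(subsetP LI) yI /(subsetP LI); apply: Istab.
- by apply: contraNneq xI => <-.
- by rewrite adj_sym.
move=> y yL; have yI := subsetP LI _ yL; split; last exact: Istab.
by apply: contraNneq xw => ->; have := subsetP Lx _ yL; rewrite inE.
Qed.

Lemma nonA_degree x : x \in H -> #|nbrs x :&: H| <= D.
Proof.
move=> xH; rewrite -(cardsID I) addnC leq_add //; last first.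
  apply: leq_trans (few_nbrs_in_stable xH); apply/subset_leq_card.
  by rewrite -setIA setIS // subsetIr.
apply/ltnW; rewrite ltnNge; apply/negP => /large_has_stable[L [LN Lst Ls]].
have LNP y : y \in L -> [/\ y \notin I, adj x y & y \in H].
  by move/(subsetP LN); rewrite in_setD !in_setI inE => /andP[-> /andP[]].
(* [Z] contains every vertex of [I] that fails as the isolated point: the neighbours of the [s]
   leaves, those of [x], and [x] itself. Its size explains the threshold in [I_big]. *)
pose Z := (\bigcup_(y in L) (nbrs y :&: I)) :|: (nbrs x :&: I) :|: [set x].
have Zcard : #|Z| <= s * s + s + 1.
  rewrite (leq_trans (leq_card_setU _ _)) // cards1 leq_add2r.
  rewrite (leq_trans (leq_card_setU _ _)) // leq_add ?few_nbrs_in_stable //.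
  rewrite -{1}Ls; apply: card_bigcup_le => y /LNP[_ _ yH].
  exact: few_nbrs_in_stable.
have /subsetPn[w wI] : ~~ (I \subset Z).
  by apply/negP => /subset_leq_card; rewrite leqNgt (leq_ltn_trans Zcard).
rewrite !inE !negb_or wI andbT => /andP[/andP[/bigcupP wL xw] wx].
apply: (no_induced_star_plus_point Gstar Lst Ls _ wx).
- by apply/subsetP => y /LNP[_ xy _]; rewrite inE.
- by rewrite adj_sym.
move=> y yL; have [yI _ _] := LNP y yL; split.
  by apply: contraNneq yI => <-.
by apply/negP => wy; apply: wL; exists y; rewrite // !inE adj_sym wy.
Qed.

Let C := comp H.
(** One canonical representative, not necessarily in [I], for each component of G[H] that meets
    [I]. *)
Let Rts := [set root (radj H) w | w in I].

Lemma roots_card : #|I| <= #|Rts| * D.+1 ^ 3.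
Proof.
apply: (@leq_trans #|\bigcup_(r in Rts) C r|); last first.
  by apply: card_bigcup_le => r _; apply: comp_card nonA_degree.
apply/subset_leq_card/subsetP => w wI; apply/bigcupP.
exists (root (radj H) w); first exact: imset_f.
by rewrite inE radj_connect_sym connect_root.
Qed.

Lemma root_in_nonA r : r \in Rts -> r \in H.
Proof.
case/imsetP => w wI ->.
by apply: (subsetP (comp_sub (subsetP stable_sub_nonA _ wI))); rewrite inE connect_root.
Qed.

Lemma root_comp_stable r : r \in Rts -> exists2 w, w \in I & w \in C r.
Proof.
by case/imsetP => w wI ->; exists w; rewrite // inE radj_connect_sym connect_root.
Qed.

Lemma comp_inj r r' x : r \in Rts -> r' \in Rts -> x \in C r -> x \in C r' -> r = r'.
Proof.
case/imsetP => w _ -> /imsetP[w' _ ->]; rewrite !inE => xr xr'.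
have cs := @radj_connect_sym _ H.
have := connect_trans xr; rewrite cs in xr' => /(_ _ xr').
by move/(rootP cs); rewrite !(root_root cs).
Qed.

(** Mixed edges [u v] and [u' v'] in two different components would make v, u, a, u', v' an induced
    path on five vertices. *)
Lemma mixed_on_one a r r' : a \in A -> r \in Rts -> r' \in Rts ->
  ~~ (C r \subset nbrs a) -> ~~ (C r' \subset nbrs a) -> r = r'.
Proof.
move=> aA rR r'R.
have edge q : q \in Rts -> ~~ (C q \subset nbrs a) -> exists u v,
    [/\ u \in C q, v \in C q, adj u v, adj a u & ~~ adj a v].
  move=> qR /subsetPn[z zq]; rewrite inE => az.
  (* The component meets [I], to which [a] is complete, so [a] has a neighbour in it. *)
  have [w wI wq] := root_comp_stable qR; apply: comp_mixed_edge wq zq _ az.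
  by move: aA; rewrite inE => /subsetP/(_ _ wI); rewrite inE.
move=> /(edge _ rR)[u [v [ur vr uv au av]]].
move=> /(edge _ r'R)[u' [v' [ur' vr' uv' au' av']]].
apply/eqP; apply: contraTT isT => rr'.
have CH q x : q \in Rts -> x \in C q -> x \in H.
  by move=> /root_in_nonA qH; apply: (subsetP (comp_sub qH)).
have far x y : x \in C r -> y \in C r' -> ~~ adj x y.
  move=> xr yr'; apply: contraNN rr' => xy; apply/eqP.
  apply: comp_inj (yr') => //.
  exact: comp_closed xr (CH _ _ rR xr) (CH _ _ r'R yr') xy.
by case: (@no_induced_P5 G v u a u' v' GP5);
  do [exact: far | by [] | by rewrite adj_sym].
Qed.

Lemma roots_few : #|Rts| <= k.
Proof.
rewrite leqNgt; apply/negP => Rts_big.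
have /card_gt0P[q0 q0R] : 0 < #|Rts| by apply: leq_ltn_trans Rts_big.
(* A component with least chromatic number can be recoloured with the colours
   that any other component is forced to use. *)
pose f r := chi (induced (C r)).
case: (arg_minnP f q0R) => r rR0 r_min; have {rR0} rR : r \in Rts := rR0.
(* The second root [q] is a vertex of G - r, serving as default for [colorable_extend]. Positivity
   of [k] follows from criticality at [r]. *)
have [q /setD1P[qr qR]] : exists q, q \in Rts :\ r.
  apply/card_gt0P; move: Rts_big; rewrite (cardsD1 r) rR add1n ltnS.
  by apply: leq_trans; rewrite -Gcrit.1 lt0n; apply/eqP => chi0;
    have := Gcrit.2 r; rewrite -Gcrit.1 chi0.
have q_del : q \in ~: [set r] by rewrite !inE.
have del_col : colorable (del_vertex r) k.-1.
  by rewrite -chi_leq -ltnS prednK ?(Gcrit.2) // (leq_ltn_trans _ (Gcrit.2 r)).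
have [c cP] := colorable_extend q_del del_col.
have rH := root_in_nonA rR.
have neq_del x : x != r -> x \in ~: [set r] by rewrite !inE.
pose T := [set c a | a in A].
pose rep t := [pick a in A | c a == t].
(* The root of the component, if any, to which the representative of colour [t] is not complete. The
   default [r] is excluded from the choice of [j] anyway. *)
pose bad t := odflt r (obind
  (fun a => [pick p in Rts | ~~ (C p \subset nbrs a)]) (rep t)).
(* At most 1 + (k - 1) roots are excluded, fewer than there are. *)
have /subsetPn[j jR] : ~~ (Rts \subset r |: [set bad t | t : 'I_k.-1]).
  apply/negP => /subset_leq_card; rewrite leqNgt (leq_ltn_trans _ Rts_big) //.
  rewrite (leq_trans (leq_card_setU _ _)) // cards1 add1n.
  rewrite (leq_ltn_trans (leq_imset_card _ _)) // card_ord prednK //.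
  exact: leq_ltn_trans (Gcrit.2 r).
rewrite in_setU1 negb_or => /andP[jr j_good].
have T_rep t : t \in T -> exists a, [/\ a \in A, c a = t & C j \subset nbrs a].
  case/imsetP => a0 a0A ta0; case E : (rep t) => [a|]; last first.
    by move: E; rewrite /rep; case: pickP => // /(_ a0); rewrite a0A ta0 eqxx.
  have [aA cat] : a \in A /\ c a = t.
    by move: E; rewrite /rep; case: pickP => // a1 /andP[? /eqP ?] [<-].
  exists a; split=> //; apply: contraNT j_good => aj; apply/imsetP; exists t => //.
  rewrite /bad E /=; case: pickP => [p /andP[pR ap]|/(_ j)] /=.
    exact: mixed_on_one aj ap.
  by rewrite jR aj.
have Cj_del x : x \in C j -> x != r.
  by apply: contraTneq => ->; apply: contra jr => rj;
    rewrite (comp_inj jR rR rj (comp_refl _ _)).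
(* No colour of [T] occurs on [C j], since a vertex of [A] complete to [C j] already has it;
   minimality of [r] transfers the bound to [C r]. *)
have fr_le : f r <= #|~: T|.
  apply: leq_trans (r_min _ jR) _; rewrite /f chi_leq.
  apply: (@colorable_avoiding (induced (C j)) _ T (fun x => c (val x))) => [x y xy|x].
    by apply: cP => //; apply/neq_del/Cj_del/valP.
  apply/negP => /T_rep[a [aA cax /subsetP/(_ _ (valP x))]]; rewrite inE => ax.
  have /eqP[] : c a != c (val x); last by [].
  apply: cP => //; last exact/neq_del/Cj_del/valP.
  by apply: neq_del; apply: contraTneq aA => ->; rewrite -in_setC.
move: fr_le; rewrite chi_leq => /(colorable_extend (comp_refl _ _))[p pP].
have : colorable G k.-1.
  apply/colorableP; exists (fun x => if x \in C r then enum_val (p x) else c x).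
  (* An edge leaving [C r] ends in [A], whose colours lie in [T], while [C r] is recoloured outside
     [T]. *)
  have crossing x y : x \in C r -> y \notin C r -> adj x y -> enum_val (p x) != c y.
    move=> xr yr xy; have yA : y \in A.
      apply: contraNT yr; rewrite -in_setC => yH.
      exact: comp_closed xr (subsetP (comp_sub rH) _ xr) yH xy.
    have := enum_valP (p x); rewrite in_setC; apply: contraNneq => ->.
    exact: imset_f.
  have r_in := comp_refl H r.
  move=> x y xy; case: ifPn => xr; case: ifPn => yr.
  - by apply: contra (pP _ _ xr yr xy) => /eqP/enum_val_inj ->.
  - exact: crossing.
  - by rewrite eq_sym crossing // adj_sym.
  - by apply: cP => //; apply: neq_del;
      [apply: contraNneq xr|apply: contraNneq yr] => ->.
rewrite -chi_leq Gcrit.1 leqNgt prednK ?leqnn //.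
exact: leq_ltn_trans (Gcrit.2 r).
Qed.

Lemma stable_bound : #|I| <= k * (D.+1 ^ 3).
Proof. by apply: leq_trans roots_card _; rewrite leq_mul2r roots_few orbT. Qed.
End StableBound.

(** * Order of critical graphs *)

Definition critical_order_bound k s : nat :=
  let D := ramsey k.+1 s + s in
  ramsey k.+1 (s * s + s + 1 + k * D.+1 ^ 3).+1.

(** A larger graph would contain a clique on [k.+1] vertices, or a stable set large enough both to
    satisfy [I_big] and to violate [stable_bound]. *)
Lemma critical_order k s (G : sgraph) : vertex_critical k G ->
  free2 (path_graph 5) (dunion (star_graph s) (path_graph 1)) G ->
  #|G| < critical_order_bound k s.
Proof.
move=> Gcrit [GP5 Gstar]; rewrite ltnNge -cardsT; apply/negP.
case/ramseyP => -[K [_ KP Kcard]].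
  by have := clique_leq_chi KP; rewrite Kcard Gcrit.1 ltnn.
have Kbig : s * s + s + 1 < #|K| by rewrite Kcard ltnS leq_addr.
have := stable_bound Gcrit GP5 Gstar KP Kbig.
by rewrite Kcard leqNgt ltnS leq_addl.
Qed.

(** * Finiteness from bounded order *)

Section GraphOfSet.
Variables (n : nat) (E : {set 'I_n * 'I_n}).

(* Symmetrising makes every set of pairs a code of a graph. *)
Definition set_adj : rel 'I_n :=
  fun i j => (i != j) && (((i, j) \in E) || ((j, i) \in E)).

Fact set_adj_sym : symmetric set_adj.
Proof. by move=> i j; rewrite /set_adj eq_sym orbC. Qed.

Fact set_adj_irrefl : irreflexive set_adj.
Proof. by move=> i; rewrite /set_adj eqxx. Qed.

Definition set_graph : sgraph := SGraph set_adj_sym set_adj_irrefl.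
End GraphOfSet.

(** Enumerating the vertices encodes a graph by its order n < N and a set of pairs of indices; such
    codes form a finite type. *)
Lemma bounded_order_finitely_many (P : sgraph -> Prop) N :
  (forall G, P G -> #|G| < N) -> finitely_many_up_to_iso P.
Proof.
move=> PN; pose code := {n : 'I_N & {set 'I_n * 'I_n}}.
exists #|{: code}|, (fun i => set_graph (tagged (enum_val i))) => G /PN GN.
pose E : {set 'I_(Ordinal GN) * 'I_(Ordinal GN)} :=
  [set p | adj (enum_val p.1 : G) (enum_val p.2)].
exists (enum_rank (Tagged (fun n : 'I_N => {set 'I_n * 'I_n}) E : code)).
rewrite enum_rankK /=; exists (@enum_rank G); first exact: enum_rank_bij.
move=> x y; rewrite /= /set_adj !inE /= !enum_rankK (inj_eq enum_rank_inj).
rewrite [adj y x]adj_sym orbb; case: eqP => [->|//].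
by rewrite adj_irrefl.
Qed.

Theorem theorem3 (s : nat) (hs : 1 <= s) :
  finitely_many_up_to_iso (fun G : sgraph =>
    vertex_critical 5 G /\
    free2 (path_graph 5) (dunion (star_graph s) (path_graph 1)) G).
Proof.
apply: (@bounded_order_finitely_many _ (critical_order_bound 5 s)) => G [].
exact: critical_order.
Qed.
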